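(* Let $N_{23}$ be the free nilpotent group of rank $2$ and nilpotency class $3$. Then its Reidemeister spectrum is $$Spec_R(N_{23}) = \{2k^2 \mid k \in \mathbb{N}\} \cup \{\infty\}.$$
   Context: Here $\mathbb{N}$ denotes the positive integers. The free nilpotent group $N_{rc}$ of rank $r$ and class $c$ is $F_r/\gamma_{c+1}(F_r)$, where $F_r$ is the free group of rank $r$ and $\gamma_i$ denotes the $i$-th term of the lower central series ($\gamma_1(G)=G$). Automorphisms are written on the right: $x\varphi$ is the image of $x$ under $\varphi$. For a group $G$ and an automorphism $\varphi$ of $G$, elements $g,f\in G$ are $\varphi$-twisted conjugate if there exists $x\in G$ with $(x\varphi)g = fx$. This is an equivalence relation; the Reidemeister number $R(\varphi)$ is the number of its equivalence classes, with $R(\varphi)=\infty$ if there are infinitely many. The Reidemeister spectrum of $G$ is $Spec_R(G)=\{R(\varphi)\mid \varphi\in Aut(G)\}$. *)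

(* Defs.v *)
From HB Require Import structures.
From mathcomp Require Import all_boot.
From mathcomp Require Import finmap.
From mathcomp Require Import boolp classical_sets functions cardinality.

Set Implicit Arguments.
Unset Strict Implicit.
Unset Printing Implicit Defensive.

Local Open Scope classical_set_scope.
Local Open Scope group_scope.
Local Open Scope quotient_scope.

Section FreeGroup.
Variable r : nat.

(* The letter (i, b) stands for the generator x_i if b = true and for its     *)
(* inverse if b = false.                                                      *)
Definition word := seq ('I_r * bool).

Inductive word_equiv : word -> word -> Prop :=
| word_equiv_refl u : word_equiv u u
| word_equiv_sym u v : word_equiv u v -> word_equiv v u
| word_equiv_trans u v w : word_equiv u v -> word_equiv v w -> word_equiv u w
| word_equiv_cancel u v i b :
    word_equiv (u ++ (i, b) :: (i, ~~ b) :: v) (u ++ v).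

Definition word_rel : rel word := fun u v => `[< word_equiv u v >].

Lemma word_rel_equiv : equiv_class_of word_rel.
Proof.
split=> [u|u v|v u w].
- exact/asboolP/word_equiv_refl.
- by apply/idP/idP => /asboolP uv; apply/asboolP/word_equiv_sym.
- by move=> /asboolP uv /asboolP vw; apply/asboolP/(word_equiv_trans uv vw).
Qed.

Canonical word_rel_equivRel := EquivRelPack word_rel_equiv.

Definition free_group := {eq_quot word_rel}.
HB.instance Definition _ := Choice.on free_group.
HB.instance Definition _ := EqQuotient.on free_group.

Definition word_inv (u : word) : word := rev [seq (a.1, ~~ a.2) | a <- u].

Lemma word_equiv_cat u u' v v' :
  word_equiv u u' -> word_equiv v v' -> word_equiv (u ++ v) (u' ++ v').
Proof.
have catl w x y : word_equiv x y -> word_equiv (w ++ x) (w ++ y).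
  elim=> [z|a b _ /word_equiv_sym //|a b c _ ab _ bc|a b i e].
  - exact: word_equiv_refl.
  - exact: word_equiv_trans ab bc.
  - by rewrite 2!catA; apply: word_equiv_cancel.
have catr w x y : word_equiv x y -> word_equiv (x ++ w) (y ++ w).
  elim=> [z|a b _ /word_equiv_sym //|a b c _ ab _ bc|a b i e].
  - exact: word_equiv_refl.
  - exact: word_equiv_trans ab bc.
  - by rewrite -!catA !cat_cons; apply: word_equiv_cancel.
by move=> uu' vv'; apply: word_equiv_trans (catr _ _ _ uu') (catl _ _ _ vv').
Qed.

Lemma word_invK : involutive word_inv.
Proof.
move=> u; rewrite /word_inv map_rev revK -map_comp -[RHS]map_id.
by apply: eq_map => -[i b] /=; rewrite negbK.
Qed.

Lemma word_equiv_inv u v :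
  word_equiv u v -> word_equiv (word_inv u) (word_inv v).
Proof.
elim=> [z|a b _ /word_equiv_sym //|a b c _ ab _ bc|a b i e].
- exact: word_equiv_refl.
- exact: word_equiv_trans ab bc.
- rewrite /word_inv !map_cat !rev_cat /= !rev_cons negbK -!cats1 -!catA /=.
  exact: word_equiv_cancel.
Qed.

Lemma word_mulV u : word_equiv (u ++ word_inv u) [::].
Proof.
elim: u => [|[i b] u IH]; first exact: word_equiv_refl.
rewrite /word_inv map_cons rev_cons -cats1 -[_ :: u]cat1s -catA [u ++ _]catA.
apply: word_equiv_trans (word_equiv_cancel [::] [::] i b).
apply: (word_equiv_cat (word_equiv_refl _)).
exact: (word_equiv_cat IH (word_equiv_refl _)).
Qed.

Lemma word_mulVl u : word_equiv (word_inv u ++ u) [::].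
Proof. by rewrite -{2}[u]word_invK; apply: word_mulV. Qed.

Lemma word_piP u v : \pi_free_group u = \pi_free_group v <-> word_equiv u v.
Proof.
split=> [/eqmodP/asboolP//|uv].
exact/eqmodP/asboolP.
Qed.

Lemma word_equiv_repr u : word_equiv (repr (\pi_free_group u)) u.
Proof. by apply/word_piP; rewrite reprK. Qed.

Definition free_mul (x y : free_group) : free_group :=
  \pi_free_group (repr x ++ repr y).
Definition free_one : free_group := \pi_free_group [::].
Definition free_inv (x : free_group) : free_group :=
  \pi_free_group (word_inv (repr x)).

Lemma free_mulE u v :
  free_mul (\pi_free_group u) (\pi_free_group v) = \pi_free_group (u ++ v).
Proof. by apply/word_piP/word_equiv_cat; apply: word_equiv_repr. Qed.

Lemma free_invE u : free_inv (\pi_free_group u) = \pi_free_group (word_inv u).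
Proof. exact/word_piP/word_equiv_inv/word_equiv_repr. Qed.

Lemma free_mulA : associative free_mul.
Proof.
move=> x y z; rewrite -[x]reprK -[y]reprK -[z]reprK.
by rewrite (free_mulE (repr y)) (free_mulE (repr x) (repr y)) !free_mulE catA.
Qed.

Lemma free_mul1 : left_id free_one free_mul.
Proof. by move=> x; rewrite -[x]reprK free_mulE. Qed.

Lemma free_mulr1 : right_id free_one free_mul.
Proof. by move=> x; rewrite -[x]reprK free_mulE cats0. Qed.

Lemma free_mulV : left_inverse free_one free_inv free_mul.
Proof.
by move=> x; rewrite -[x]reprK free_invE free_mulE; apply/word_piP/word_mulVl.
Qed.

Lemma free_mulrV : right_inverse free_one free_inv free_mul.
Proof.
by move=> x; rewrite -[x]reprK free_invE free_mulE; apply/word_piP/word_mulV.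
Qed.

HB.instance Definition _ := isGroup.Build free_group
  free_mulA free_mul1 free_mulr1 free_mulV free_mulrV.

End FreeGroup.

Record normal_subgroup (G : groupType) := NormalSubgroup {
  normal_set : set G;
  normal_group_closed : group_closed [in normal_set];
  normal_conj : forall x y, normal_set x -> normal_set (x ^ y) }.

Section Quotient.
Variables (G : groupType) (K : normal_subgroup G).
Local Notation N := (normal_set K).

Lemma normal1 : N 1.
Proof. by have [/set_mem] := normal_group_closed K. Qed.

Lemma normalF x y : N x -> N y -> N (x / y).
Proof.
move=> Nx Ny; have [_ NF] := normal_group_closed K.
by apply/set_mem/NF; apply/mem_set.
Qed.

Lemma normalV x : N x -> N x^-1.
Proof. by move=> Nx; rewrite -[x^-1]mul1g; apply: normalF normal1 Nx. Qed.

Lemma normalM x y : N x -> N y -> N (x * y).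
Proof. by move=> Nx Ny; rewrite -[y]invgK; apply/normalF/normalV. Qed.

Definition coset_rel : rel G := fun x y => `[< N (x^-1 * y) >].

Lemma coset_rel_equiv : equiv_class_of coset_rel.
Proof.
split=> [x|x y|y x z].
- by apply/asboolP; rewrite mulVg; apply: normal1.
- by apply/idP/idP => /asboolP/normalV; rewrite invgM invgK => ?; apply/asboolP.
- move=> /asboolP Nxy /asboolP Nyz; apply/asboolP.
  by have := normalM Nxy Nyz; rewrite mulgA mulgK.
Qed.

Canonical coset_rel_equivRel := EquivRelPack coset_rel_equiv.

Definition quotient_group := {eq_quot coset_rel}.
HB.instance Definition _ := Choice.on quotient_group.
HB.instance Definition _ := EqQuotient.on quotient_group.

Lemma coset_piP x y :
  \pi_quotient_group x = \pi_quotient_group y <-> N (x^-1 * y).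
Proof.
split=> [/eqmodP/asboolP//|xy].
exact/eqmodP/asboolP.
Qed.

Lemma coset_repr x : N ((repr (\pi_quotient_group x))^-1 * x).
Proof. by apply/coset_piP; rewrite reprK. Qed.

Definition quotient_mul (x y : quotient_group) : quotient_group :=
  \pi_quotient_group (repr x * repr y).
Definition quotient_one : quotient_group := \pi_quotient_group 1.
Definition quotient_inv (x : quotient_group) : quotient_group :=
  \pi_quotient_group (repr x)^-1.

Lemma quotient_mulE x y :
  quotient_mul (\pi_quotient_group x) (\pi_quotient_group y) = \pi_quotient_group (x * y).
Proof.
apply/coset_piP; set a := repr _; set b := repr _.
have -> : (a * b)^-1 * (x * y) = (a^-1 * x) ^ b * (b^-1 * y).
  by rewrite /conjg invgM -!mulgA [b * (_ * _)]mulgA mulgV mul1g.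
by apply: normalM; [apply/normal_conj|]; apply: coset_repr.
Qed.

Lemma quotient_invE x : quotient_inv (\pi_quotient_group x) = \pi_quotient_group x^-1.
Proof.
apply/coset_piP; set a := repr _; rewrite invgK.
have -> : a * x^-1 = (x^-1 * a) ^ x^-1.
  by rewrite /conjg invgK !mulgA mulgV mul1g.
by apply: normal_conj; rewrite -[a]invgK -invgM; apply/normalV/coset_repr.
Qed.

Lemma quotient_mulA : associative quotient_mul.
Proof.
move=> x y z; rewrite -[x]reprK -[y]reprK -[z]reprK.
by rewrite (quotient_mulE (repr y)) (quotient_mulE (repr x) (repr y))
  !quotient_mulE mulgA.
Qed.

Lemma quotient_mul1 : left_id quotient_one quotient_mul.
Proof. by move=> x; rewrite -[x]reprK quotient_mulE mul1g. Qed.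

Lemma quotient_mulr1 : right_id quotient_one quotient_mul.
Proof. by move=> x; rewrite -[x]reprK quotient_mulE mulg1. Qed.

Lemma quotient_mulV : left_inverse quotient_one quotient_inv quotient_mul.
Proof. by move=> x; rewrite -[x]reprK quotient_invE quotient_mulE mulVg. Qed.

Lemma quotient_mulrV : right_inverse quotient_one quotient_inv quotient_mul.
Proof. by move=> x; rewrite -[x]reprK quotient_invE quotient_mulE mulgV. Qed.

HB.instance Definition _ := isGroup.Build quotient_group
  quotient_mulA quotient_mul1 quotient_mulr1 quotient_mulV quotient_mulrV.

End Quotient.

Section LowerCentralSeries.
Variable G : groupType.

Definition generated_subgroup (S : set G) : set G :=
  smallest [set H : set G | group_closed [in H]] S.

(* Numbered from gamma_1(G) = G; the index 0 is a junk value, also set to G. *)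
Fixpoint lower_central (i : nat) : set G :=
  if i is (_.+1 as j).+1 then
    generated_subgroup [set [~ x, y] | x in lower_central j & y in setT]
  else setT.

Lemma generated_subgroup_closed S : group_closed [in generated_subgroup S].
Proof.
split=> [|x y /set_mem Sx /set_mem Sy]; apply/mem_set => H [].
  by move=> -[/set_mem].
move=> cH SH; have [_ HF] := cH; apply/set_mem/HF; apply/mem_set.
  exact: Sx.
exact: Sy.
Qed.

Lemma lower_central_closed i : group_closed [in lower_central i].
Proof.
case: i => [|[|i]]; last exact: generated_subgroup_closed.
  by split=> [|x y _ _]; apply/mem_set.
by split=> [|x y _ _]; apply/mem_set.
Qed.

Lemma lower_central_conj i x y : lower_central i x -> lower_central i (x ^ y).
Proof.
elim: i x y => [//|[//|i] IH] x y.
pose C := [set [~ x, y] | x in lower_central i.+1 & y in setT].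
move=> /(_ [set z | generated_subgroup C (z ^ y)]); apply.
split=> [|_ [a ga [b _ <-]]].
  have [C1 CF] := generated_subgroup_closed C.
  split=> [|u v /set_mem /= Cu /set_mem /= Cv]; apply/mem_set => /=.
    by rewrite conj1g; apply/set_mem.
  by rewrite conjMg conjVg; apply/set_mem/CF; apply/mem_set.
rewrite /= conjRg; apply: sub_gen_smallest.
by exists (a ^ y); [apply: IH|exists (b ^ y)].
Qed.

Definition lower_central_normal i : normal_subgroup G :=
  NormalSubgroup (lower_central_closed i) (@lower_central_conj i).

End LowerCentralSeries.

Definition free_nilpotent (r c : nat) : groupType :=
  quotient_group (lower_central_normal (free_group r) c.+1).

Section Reidemeister.
Variable G : groupType.

Definition twisted_conj (phi : G -> G) (g f : G) : Prop :=
  exists x, phi x * g = f * x.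

Definition twisted_classes (phi : G -> G) : set (set G) :=
  range (fun g => [set f | twisted_conj phi g f]).

(* None stands for infinity. *)
Definition reidemeister_number (phi : G -> G) : option nat :=
  if `[< finite_set (twisted_classes phi) >]
  then Some #|` fset_set (twisted_classes phi)|%fset else None.

Definition reidemeister_spectrum : set (option nat) :=
  [set reidemeister_number phi |
     phi in [set phi : {multiplicative G -> G} | bijective phi]].

End Reidemeister.

(* Main.v *)
Require Import Defs.
From HB Require Import structures.
From mathcomp Require Import all_boot all_order all_algebra.
From mathcomp Require Import finmap.
From mathcomp Require Import boolp classical_sets functions cardinality.
From mathcomp Require Import zify ring.

Set Implicit Arguments.
Unset Strict Implicit.
Unset Printing Implicit Defensive.

Import Order.TTheory GRing.Theory Num.Theory.
Local Open Scope classical_set_scope.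
Local Open Scope group_scope.
Local Open Scope quotient_scope.

(** Let N be the free nilpotent group of rank 2 and class 3 on x and y, and put
    z = [y, x], u = [z, x], v = [z, y]. Every element of N has a unique normal
    form x^a y^b z^c u^d v^e. Existence ([normal_form_exists]) follows by adding
    v, u, z, y, x one at a time, each being central modulo the previous ones.
    Uniqueness ([normal_formK]) follows from two homomorphisms to the group of
    integer shifts and quadratic polynomials, which is nilpotent of class 3
    ([lower_central4_shift]); they come from the universal property
    [free_nilpotent_lift]. So the factors of the lower central series are Z^2
    with coordinates (a, b), Z with coordinate c, and Z^2 with coordinates (d, e).

    An endomorphism with matrix A on the abelianization acts on these factors by
    A, by D = det A and by D A ([layer1_endo], [layer2_endo], [layer3_endo]),
    because the commutator is bilinear on them. A filtration argument
    ([reidemeister_layers]) shows that the Reidemeister number is the product of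
    the indices of A - 1, D - 1 and D A - 1 when A - 1 and D - 1 are injective
    and the indices are finite, and the Smith normal form gives the indices as
    determinants ([transversal_mulmx]).

    For an automorphism D is 1 or -1. If D = 1 the number is infinite because of
    the second factor, or already because of the first one. If D = -1, then
    det (A - 1) = - tr A and det (- A - 1) = tr A, so that the number is
    2 |tr A|^2, or infinite if tr A = 0. Every positive trace k occurs for the
    automorphism x |-> x^k y, y |-> x ([automorphism_exists]), and the identity
    has infinite Reidemeister number. *)

(** * Group homomorphisms and integer powers *)

Section Morphisms.
Variables (G H : groupType) (f : {multiplicative G -> H}).

Lemma gmorph1 : f 1 = 1.
Proof. by apply: (mulgI (f 1)); rewrite -gmulfM !mulg1. Qed.

Lemma gmorphV : {morph f : x / x^-1}.
Proof. by move=> x; apply: (mulgI (f x)); rewrite -gmulfM !mulgV gmorph1. Qed.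

Lemma gmorphR : {morph f : x y / [~ x, y]}.
Proof. by move=> x y; rewrite /commg /conjg !gmulfM !gmorphV. Qed.

End Morphisms.

Section IntPower.
Variable G : groupType.
Implicit Types (g h : G) (m n : int).

Definition expgz g n : G :=
  match n with Posz k => g ^+ k | Negz k => g ^- k.+1 end.

Lemma expgzS g n : expgz g (n + 1)%R = g * expgz g n.
Proof.
case: n => [n|[|n]].
- have -> : (Posz n + 1)%R = Posz n.+1 by lia.
  exact: expgS.
- by rewrite /= mulgV.
have -> : (Negz n.+1 + 1)%R = Negz n by lia.
by rewrite /= [g ^+ n.+2]expgSr invgM mulVKg.
Qed.

Lemma expgzB1 g n : expgz g (n - 1)%R = g^-1 * expgz g n.
Proof. by rewrite -{2}[n](subrK 1%R) expgzS mulKg. Qed.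

Lemma expgzD g m n : expgz g (m + n)%R = expgz g m * expgz g n.
Proof.
elim: m => [|m IH|m IH].
- by rewrite add0r mul1g.
- by rewrite -addn1 PoszD addrAC expgzS IH expgzS mulgA.
- by rewrite -addn1 PoszD opprD addrAC expgzB1 IH expgzB1 mulgA.
Qed.

Lemma expgzN g n : expgz g (- n)%R = (expgz g n)^-1.
Proof. by apply: (mulgI (expgz g n)); rewrite -expgzD subrr mulgV. Qed.

(** A homomorphism from the integers is determined by its value at 1; this
    computes powers in a concrete group from a closed formula. *)
Lemma expgz_unique (e : int -> G) :
  (forall m n, e (m + n)%R = e m * e n) -> forall n, e n = expgz (e 1%R) n.
Proof.
move=> eD.
have e0 : e 0%R = 1 by apply: (mulgI (e 0%R)); rewrite -eD addr0 mulg1.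
have eS n : e (n + 1)%R = e 1%R * e n by rewrite addrC eD.
elim=> [//|m IH|m IH].
- by rewrite -addn1 PoszD eS expgzS IH.
- rewrite -addn1 PoszD opprD expgzB1 -IH.
  by apply: (mulgI (e 1%R)); rewrite mulVKg -eS subrK.
Qed.

End IntPower.

Arguments expgz : simpl never.

Lemma gmorph_expgz (G H : groupType) (f : {multiplicative G -> H}) g n :
  f (expgz g n) = expgz (f g) n.
Proof.
by apply: (expgz_unique (e := fun n => f (expgz g n))) => i j; rewrite expgzD gmulfM.
Qed.

(** * The lower central series under homomorphisms *)

Lemma lower_centralS (G : groupType) i (x y : G) :
  @lower_central G i.+1 x -> @lower_central G i.+2 [~ x, y].
Proof. by move=> gx; apply: sub_gen_smallest; exists x => //; exists y. Qed.

(** Upper bounds on the terms of the series are proved by exhibiting a subgroup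
    that contains the generating commutators. *)
Lemma lower_central_sub (G : groupType) i (K : set G) :
  group_closed [in K] ->
  (forall x y, @lower_central G i.+1 x -> K [~ x, y]) ->
  @lower_central G i.+2 `<=` K.
Proof. by move=> cK KR g; apply; split=> // _ [x gx [y _ <-]]; apply: KR. Qed.

Lemma group_closedP (G : groupType) (K : set G) :
  K 1 -> (forall x y, K x -> K y -> K (x * y)) -> (forall x, K x -> K x^-1) ->
  group_closed [in K].
Proof.
move=> K1 KM KV; split; first exact/mem_set.
by move=> x y /set_mem Kx /set_mem Ky; apply/mem_set/KM/KV.
Qed.

Lemma lower_central_gmorph (G H : groupType) (f : {multiplicative G -> H}) i g :
  @lower_central G i g -> @lower_central H i (f g).
Proof.
case: i => // i; elim: i g => // i IH.
have [/set_mem H1 HF] := @lower_central_closed H i.+2.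
apply: (@lower_central_sub _ _ (f @^-1` @lower_central H i.+2)) => [|x y gx].
  split; first by apply/mem_set; rewrite /= gmorph1.
  move=> x y /set_mem Kx /set_mem Ky; apply/mem_set.
  by rewrite /= gmulfM gmorphV; apply/set_mem/HF; apply/mem_set.
by rewrite /= gmorphR; apply: lower_centralS; apply: IH.
Qed.

(** Commutators lift along a surjection, so the series of the image is covered
    by the series of the source; this is how a quotient by a term of the lower
    central series is seen to be nilpotent. *)
Lemma lower_central_surj (G H : groupType) (f : {multiplicative G -> H}) i h :
  (forall h, exists g, f g = h) ->
  @lower_central H i h -> exists2 g, @lower_central G i g & f g = h.
Proof.
move=> fsurj; case: i => [_|i]; first by have [g <-] := fsurj h; exists g.
elim: i h => [h _|i IH]; first by have [g <-] := fsurj h; exists g.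
have [/set_mem G1 GF] := @lower_central_closed G i.+2.
apply: (@lower_central_sub _ _ (f @` @lower_central G i.+2)) => [|x y hx].
  split; first by apply/mem_set; exists 1; [|apply: gmorph1].
  move=> _ _ /set_mem[x gx <-] /set_mem[y gy <-]; apply/mem_set.
  exists (x / y); last by rewrite gmulfM gmorphV.
  by apply/set_mem/GF; apply/mem_set.
have [[x' gx' <-] [y' <-]] := (IH _ hx, fsurj y).
by exists [~ x', y']; [apply: lower_centralS | rewrite gmorphR].
Qed.

(** * The universal property of free nilpotent groups *)

Section Universal.
Variables (r c : nat).
Local Notation F := (free_group r).
Local Notation N := (free_nilpotent r c).
Local Notation K := (lower_central_normal F c.+1).

Definition gen (i : 'I_r) : N :=
  \pi_(quotient_group K) (\pi_(free_group r) [:: (i, true)]).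

Lemma quotientM (g h : F) :
  \pi_(quotient_group K) (g * h) =
  (\pi_(quotient_group K) g : N) * \pi_(quotient_group K) h.
Proof. by rewrite -quotient_mulE. Qed.

HB.instance Definition _ :=
  isMultiplicative.Build F N (\pi_(quotient_group K)) quotientM.

Lemma free_nilpotent_ind (P : set N) :
  group_closed [in P] -> (forall i, P (gen i)) -> forall g, P g.
Proof.
move=> [/set_mem P1 PF] Pgen g.
have PV x : P x -> P x^-1.
  by move=> Px; rewrite -div1g; apply/set_mem/PF; apply/mem_set.
have PM x y : P x -> P y -> P (x * y).
  by move=> Px Py; rewrite -[y]invgK; apply/set_mem/PF; apply/mem_set => //; apply: PV.
rewrite -[g]reprK -[repr g]reprK; elim: (repr (repr g)) => [//|[i b] w IH].
rewrite -cat1s -free_mulE quotientM; apply: PM => //.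
case: b; first exact: Pgen.
have -> : \pi_(free_group r) [:: (i, false)] = (\pi_(free_group r) [:: (i, true)])^-1.
  by rewrite [RHS]free_invE.
by rewrite gmorphV; apply/PV/Pgen.
Qed.

Lemma lower_central_free_nilpotent (g : N) : @lower_central N c.+1 g -> g = 1.
Proof.
have surj (h : N) : exists x, \pi_(quotient_group K) x = h.
  by exists (repr h); apply: reprK.
move=> /(lower_central_surj surj)[x gx <-].
apply/coset_piP; rewrite mulg1; apply: (normalV (K := K)); exact: gx.
Qed.

Variables (H : groupType) (f : 'I_r -> H).
Hypothesis H_nil : forall h, @lower_central H c.+1 h -> h = 1.

Definition letter_eval (a : 'I_r * bool) : H := if a.2 then f a.1 else (f a.1)^-1.

Definition word_eval (w : word r) : H := \prod_(a <- w) letter_eval a.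

Lemma word_eval_equiv u v : word_equiv u v -> word_eval u = word_eval v.
Proof.
elim=> [//|a b _ -> //|a b d _ -> _ -> //|a b i e].
rewrite /word_eval !big_cat !big_cons /=; congr (_ * _).
by rewrite mulgA /letter_eval /=; case: e; rewrite /= ?mulgV ?mulVg mul1g.
Qed.

Definition free_eval (g : F) : H := word_eval (repr g).

Lemma free_evalE w : free_eval (\pi_(free_group r) w) = word_eval w.
Proof. exact/word_eval_equiv/word_equiv_repr. Qed.

Lemma free_evalM : {morph free_eval : x y / x * y}.
Proof.
move=> x y; rewrite -[x]reprK -[y]reprK -[_ * _]/(free_mul _ _) free_mulE.
by rewrite !free_evalE /word_eval big_cat.
Qed.

HB.instance Definition _ := isMultiplicative.Build F H free_eval free_evalM.

Definition nilpotent_eval (g : N) : H := free_eval (repr g).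

Lemma nilpotent_evalE x :
  nilpotent_eval (\pi_(quotient_group K) x) = free_eval x.
Proof.
apply: (mulgI (free_eval (repr (\pi_(quotient_group K) x)))^-1).
rewrite mulVg -gmorphV -gmulfM; apply/esym/H_nil.
by apply: lower_central_gmorph; apply: coset_repr.
Qed.

Lemma nilpotent_evalM : {morph nilpotent_eval : x y / x * y}.
Proof.
move=> x y; rewrite -[x]reprK -[y]reprK -quotientM !nilpotent_evalE.
exact: gmulfM.
Qed.

(** Words are evaluated in H, then the kernel of the quotient map is killed
    because a homomorphism respects the lower central series. *)
Lemma free_nilpotent_lift :
  exists h : {multiplicative N -> H}, forall i, h (gen i) = f i.
Proof.
have mix := isMultiplicative.Build N H nilpotent_eval nilpotent_evalM.
exists (HB.pack_for {multiplicative N -> H} nilpotent_eval mix) => i /=.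
by rewrite nilpotent_evalE free_evalE /word_eval big_seq1.
Qed.

End Universal.

Lemma gmorph_eq_gen r c (H : groupType)
    (f g : {multiplicative free_nilpotent r c -> H}) :
  (forall i, f (gen c i) = g (gen c i)) -> f =1 g.
Proof.
move=> fg; apply: (@free_nilpotent_ind _ _ [set x | f x = g x]) => //.
apply: group_closedP => [|x y /= fx fy|x /= fx].
- by rewrite /= !gmorph1.
- by rewrite !gmulfM fx fy.
- by rewrite !gmorphV fx.
Qed.

(** * Counting twisted conjugacy classes *)

Section TwistedConjugacy.
Variables (G : groupType) (phi : {multiplicative G -> G}).

Lemma twisted_conj_refl g : twisted_conj phi g g.
Proof. by exists 1; rewrite gmorph1 mul1g mulg1. Qed.

Lemma twisted_conj_sym f g : twisted_conj phi f g -> twisted_conj phi g f.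
Proof.
move=> [x xfg]; exists x^-1.
by rewrite gmorphV; apply: (mulgI (phi x)); rewrite mulVKg mulgA xfg mulgK.
Qed.

Lemma twisted_conj_trans f g h :
  twisted_conj phi f g -> twisted_conj phi g h -> twisted_conj phi f h.
Proof.
move=> [x xfg] [y ygh]; exists (y * x).
by rewrite gmulfM -mulgA xfg mulgA ygh mulgA.
Qed.

Lemma twisted_conj_shift x g : twisted_conj phi g (phi x * g * x^-1).
Proof. by exists x; rewrite mulgVK. Qed.

Let class g := [set f | twisted_conj phi g f].

Lemma twisted_class_eqP f g : class f = class g <-> twisted_conj phi f g.
Proof.
split=> [fg|fg]; first by have : class g g := twisted_conj_refl g; rewrite -fg.
apply/seteqP; split=> h; apply: twisted_conj_trans => //.
exact: twisted_conj_sym.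
Qed.

Lemma reidemeister_transversal (s : seq G) :
  uniq s ->
  (forall g, exists2 f, f \in s & twisted_conj phi g f) ->
  {in s &, forall f g, twisted_conj phi f g -> f = g} ->
  reidemeister_number phi = Some (size s).
Proof.
move=> s_uniq s_all s_inj.
have classes : twisted_classes phi = [set` [fset class f | f in s]%fset].
  apply/seteqP; split=> [_ [g _ <-]|_ /imfsetP[f /= fs ->]]; last by exists f.
  have [f fs gf] := s_all g; apply/imfsetP; exists f => //=.
  exact/twisted_class_eqP.
rewrite /reidemeister_number classes; case: asboolP => [fin|]; last first.
  by case; apply: finite_fset.
rewrite set_fsetK card_in_imfset /=; first by rewrite undup_id.
by move=> f g fs gs /twisted_class_eqP; apply: s_inj.
Qed.

Lemma reidemeister_infinite (e : nat -> G) :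
  (forall i j, twisted_conj phi (e i) (e j) -> i = j) ->
  reidemeister_number phi = None.
Proof.
move=> e_inj; rewrite /reidemeister_number; case: asboolP => // fin.
have inj : {in (class \o e) @^-1` twisted_classes phi &, injective (class \o e)}.
  by move=> i j _ _ /twisted_class_eqP/e_inj.
suff : infinite_set [set: nat].
  by case; apply: sub_finite_set (finite_preimage inj fin) => i _; exists (e i).
exact/infiniteP/card_lexx.
Qed.

End TwistedConjugacy.

(** The elements of s represent the cosets of the image of f - 1: these are the
    twisted conjugacy classes of f on an abelian group. *)
Definition coset_transversal (V : zmodType) (f : V -> V) (s : seq V) :=
  [/\ uniq s, forall v, exists m, (v + (f m - m))%R \in s
    & {in s &, forall v w, (exists m, v - w = f m - m)%R -> v = w}].

(** In this section l1, l2, l3 are the successive coordinates along a filtration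
    of G by three steps with abelian factors V1, V2, V3, and phi induces f_i
    on V_i. The coordinate l2 is additive when one of the two elements
    lies in the kernel of l1, and likewise for l3 and the kernel of l2. *)
Section Layers.
Variables (G : groupType) (phi : {multiplicative G -> G}).
Variables (V1 V2 V3 : zmodType).
Variables (l1 : G -> V1) (l2 : G -> V2) (l3 : G -> V3).
Variables (f1 : V1 -> V1) (f2 : V2 -> V2) (f3 : V3 -> V3).
Hypothesis l1M : forall g h, l1 (g * h) = (l1 g + l1 h)%R.
Hypothesis l2M : forall g h, l1 g = 0%R ->
  l2 (g * h) = (l2 g + l2 h)%R /\ l2 (h * g) = (l2 h + l2 g)%R.
Hypothesis l3M : forall g h, l1 g = 0%R -> l2 g = 0%R ->
  l3 (g * h) = (l3 g + l3 h)%R /\ l3 (h * g) = (l3 h + l3 g)%R.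
Hypothesis l_inj : forall g h, l1 g = l1 h -> l2 g = l2 h -> l3 g = l3 h -> g = h.
Hypothesis l_surj : forall v1 v2 v3,
  exists g, [/\ l1 g = v1, l2 g = v2 & l3 g = v3].
Hypothesis phi1 : forall g, l1 (phi g) = f1 (l1 g).
Hypothesis phi2 : forall g, l1 g = 0%R -> l2 (phi g) = f2 (l2 g).
Hypothesis phi3 : forall g, l1 g = 0%R -> l2 g = 0%R -> l3 (phi g) = f3 (l3 g).
Hypothesis f1_0 : f1 0 = 0%R.
Hypothesis f2_0 : f2 0 = 0%R.

Lemma layer1_1 : l1 1 = 0%R.
Proof. by apply: (addrI (l1 1)); rewrite -l1M mulg1 addr0. Qed.

Lemma layer2_1 : l2 1 = 0%R.
Proof.
by apply: (addrI (l2 1)); rewrite -(l2M _ layer1_1).1 mulg1 addr0.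
Qed.

Lemma layer3_1 : l3 1 = 0%R.
Proof.
by apply: (addrI (l3 1)); rewrite -(l3M _ layer1_1 layer2_1).1 mulg1 addr0.
Qed.

Lemma layer1V g : l1 g^-1 = (- l1 g)%R.
Proof. by apply: (addrI (l1 g)); rewrite -l1M mulgV layer1_1 subrr. Qed.

Lemma layer2V g : l1 g = 0%R -> l2 g^-1 = (- l2 g)%R.
Proof.
by move=> g1; apply: (addrI (l2 g)); rewrite -(l2M _ g1).1 mulgV layer2_1 subrr.
Qed.

Lemma layer3V g : l1 g = 0%R -> l2 g = 0%R -> l3 g^-1 = (- l3 g)%R.
Proof.
move=> g1 g2; apply: (addrI (l3 g)).
by rewrite -(l3M _ g1 g2).1 mulgV layer3_1 subrr.
Qed.

Let phi1_0 g : l1 g = 0%R -> l1 (phi g) = 0%R.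
Proof. by rewrite phi1 => ->. Qed.

Let phi2_0 g : l1 g = 0%R -> l2 g = 0%R -> l2 (phi g) = 0%R.
Proof. by move=> g1; rewrite phi2 // => ->. Qed.

Lemma layer1_shift x g :
  l1 (phi x * g * x^-1) = (l1 g + (f1 (l1 x) - l1 x))%R.
Proof. by rewrite !l1M layer1V phi1 addrA [X in (X - _)%R]addrC. Qed.

Lemma layer2_shift x g : l1 x = 0%R ->
  l2 (phi x * g * x^-1) = (l2 g + (f2 (l2 x) - l2 x))%R.
Proof.
move=> x1; have x1' : l1 x^-1 = 0%R by rewrite layer1V x1 oppr0.
rewrite (l2M _ x1').2 (l2M _ (phi1_0 x1)).1 layer2V // phi2 //.
by rewrite addrA [X in (X - _)%R]addrC.
Qed.

Lemma layer3_shift x g : l1 x = 0%R -> l2 x = 0%R ->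
  l3 (phi x * g * x^-1) = (l3 g + (f3 (l3 x) - l3 x))%R.
Proof.
move=> x1 x2; have x1' : l1 x^-1 = 0%R by rewrite layer1V x1 oppr0.
have x2' : l2 x^-1 = 0%R by rewrite layer2V // x2 oppr0.
rewrite (l3M _ x1' x2').2 (l3M _ (phi1_0 x1) (phi2_0 x1 x2)).1.
by rewrite layer3V // phi3 // addrA [X in (X - _)%R]addrC.
Qed.

Lemma twisted_conjE f g :
  twisted_conj phi f g -> exists x, g = phi x * f * x^-1.
Proof. by move=> [x xfg]; exists x; rewrite xfg mulgK. Qed.

Hypothesis f1_fix : forall v, f1 v = v -> v = 0%R.

Lemma layer_section : exists e : V1 * V2 * V3 -> G,
  forall t, [/\ l1 (e t) = t.1.1, l2 (e t) = t.1.2 & l3 (e t) = t.2].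
Proof.
have surj t : exists g, [/\ l1 g = t.1.1, l2 g = t.1.2 & l3 g = t.2] by [].
by have [e eP] := choice surj; exists e.
Qed.

(** An element is moved into the transversal of one factor after the other, and
    the elements available at each step act on the next coordinate by the
    translations f_i - 1. Conversely, an element x that conjugates two chosen
    representatives satisfies f1 (l1 x) = l1 x, so that l1 x = 0 and x belongs to
    the second step, and so on. Thus the number of classes is the product of the
    indices. *)
Lemma reidemeister_layers s1 s2 s3 :
  (forall v, f2 v = v -> v = 0%R) ->
  coset_transversal f1 s1 -> coset_transversal f2 s2 -> coset_transversal f3 s3 ->
  reidemeister_number phi = Some (size s1 * size s2 * size s3)%N.
Proof.
move=> f2_fix [u1 all1 inj1] [u2 all2 inj2] [u3 all3 inj3].
have [e eP] := layer_section.
pose s := [seq e t | t <- [seq (t, t3) | t <- [seq (t1, t2) | t1 <- s1, t2 <- s2],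
                                        t3 <- s3]].
have sP g : reflect [/\ l1 g \in s1, l2 g \in s2 & l3 g \in s3] (g \in s).
  apply: (iffP mapP) => [[t /allpairsP[[[t1 t2] t3] /= [/allpairsP]]]|[g1 g2 g3]].
    move=> [[{}t1 {}t2] /= [t1s t2s [-> ->]]] t3s ->  ->.
    by have [/= -> -> ->] := eP (t1, t2, t3).
  exists (l1 g, l2 g, l3 g); last by have [] := eP (l1 g, l2 g, l3 g) => *; apply: l_inj.
  by apply: allpairs_f => //; apply: allpairs_f.
have e_inj : injective e.
  move=> [[t1 t2] t3] [[w1 w2] w3] ett.
  have [/= + + +] := eP (t1, t2, t3); rewrite ett.
  by have [/= -> -> ->] := eP (w1, w2, w3) => -> -> ->.
have -> : (size s1 * size s2 * size s3)%N = size s.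
  by rewrite size_map !size_allpairs.
apply: reidemeister_transversal.
- rewrite map_inj_uniq //; apply: allpairs_uniq => //; last by move=> [? ?] [? ?].
  by apply: allpairs_uniq => // -[? ?] [? ?].
- move=> g.
  have [m1 g1] := all1 (l1 g); have [x1 [x11 _ _]] := l_surj m1 0%R 0%R.
  set g' := phi x1 * g * x1^-1.
  have g'1 : l1 g' \in s1 by rewrite layer1_shift x11.
  have [m2 g2] := all2 (l2 g'); have [x2 [x21 x22 _]] := l_surj 0%R m2 0%R.
  set g'' := phi x2 * g' * x2^-1.
  have g''1 : l1 g'' \in s1 by rewrite layer1_shift x21 f1_0 subrr addr0.
  have g''2 : l2 g'' \in s2 by rewrite layer2_shift // x22.
  have [m3 g3] := all3 (l3 g''); have [x3 [x31 x32 x33]] := l_surj 0%R 0%R m3.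
  exists (phi x3 * g'' * x3^-1).
    apply/sP; split; first by rewrite layer1_shift x31 f1_0 subrr addr0.
      by rewrite layer2_shift // x32 f2_0 subrr addr0.
    by rewrite layer3_shift // x33.
  do 2!apply: (twisted_conj_trans _ (twisted_conj_shift _ _ _)).
  exact: twisted_conj_shift.
- move=> f g /sP[fs1 fs2 fs3] /sP[gs1 gs2 gs3] /twisted_conjE[x gE].
  have g1 := layer1_shift x f; rewrite -gE in g1.
  have fg1 : l1 g = l1 f.
    by apply: inj1 => //; exists (l1 x); rewrite g1 addrC addKr.
  have x1 : l1 x = 0%R.
    by apply/f1_fix/subr0_eq/(addrI (l1 f)); rewrite -g1 addr0.
  have g2 := layer2_shift f x1; rewrite -gE in g2.
  have fg2 : l2 g = l2 f.
    by apply: inj2 => //; exists (l2 x); rewrite g2 addrC addKr.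
  have x2 : l2 x = 0%R.
    by apply/f2_fix/subr0_eq/(addrI (l2 f)); rewrite -g2 addr0.
  have g3 := layer3_shift f x1 x2; rewrite -gE in g3.
  apply: l_inj => //; apply/esym/inj3 => //.
  by exists (l3 x); rewrite g3 addrC addKr.
Qed.

End Layers.

(** * Cokernels of integer matrices *)

Section Cokernel.
Local Open Scope ring_scope.

Lemma absz_det_unitmx n (L : 'M[int]_n) : L \in unitmx -> `|\det L|%N = 1%N.
Proof. by rewrite unitmxE; rewrite qualifE /= => /orP[]/eqP->. Qed.

Lemma eq_of_absz_lt (a b : nat) (d k : int) :
  (a < `|d|)%N -> (b < `|d|)%N -> a%:Z - b%:Z = d * k -> a = b.
Proof.
move=> ad bd abdk; have [k0|k0] := eqVneq k 0.
  by move: abdk; rewrite k0 mulr0; lia.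
have : (`|d| <= `|d| * `|k|)%N by rewrite leq_pmulr // absz_gt0.
by rewrite -abszM -abdk; lia.
Qed.

(** By the Smith normal form M - 1 may be replaced by a diagonal matrix, for which
    the vectors of remainders modulo the diagonal entries are representatives. *)
Lemma transversal_mulmx n (M : 'M[int]_n) : (\det (M - 1%:M) != 0) ->
  exists s, coset_transversal (fun v : 'cV[int]_n => M *m v) s
            /\ size s = `|\det (M - 1%:M)|%N.
Proof.
move=> detB0; set B := (M - 1%:M) in detB0 *.
have MB (m : 'cV[int]_n) : (M *m m - m = B *m m) by rewrite mulmxBl mul1mx.
have [L Lu [R Ru [d _ BE]]] := int_Smith_normal_form B.
set D := (\matrix_(i, j) _) in BE.
have DE : D = diag_mx (\row_j d`_j).
  by apply/matrixP => i j; rewrite !mxE -val_eqE /=; case: eqP => // ->.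
have detBE : `|\det B|%N = (\prod_(i < n) `|(d`_i)%R|)%N.
  rewrite BE !det_mulmx !abszM (absz_det_unitmx Lu) (absz_det_unitmx Ru) muln1 mul1n DE det_diag.
  by rewrite (big_morph absz abszM (erefl _)); apply: eq_bigr => i _; rewrite mxE.
have d0 i : (i < n)%N -> (d`_i) != 0.
  move=> lt_in; move: detB0; rewrite -absz_eq0 detBE -lt0n.
  by rewrite (bigD1 (Ordinal lt_in)) //= muln_gt0 => /andP[]; rewrite lt0n absz_eq0.
have dlt (a : int) (i : 'I_n) : (`|(a %% d`_i)%Z| < `|(d`_i)%R|)%N.
  by rewrite -ltz_nat abszE ger0_norm ?modz_ge0 ?d0 // abszE ltz_mod ?d0.
pose T := {dffun forall i : 'I_n, 'I_(`|(d`_i)%R|)}.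
pose e (t : T) : 'cV[int]_n := (L *m \col_i ((t i : nat)%:Z)).
have e_inj (t w : T) m : (e t - e w = B *m m) -> t = w.
  rewrite /e -mulmxBr BE -!mulmxA => /(can_inj (mulKmx Lu)) /colP tw.
  apply/ffunP => i; apply/val_inj => /=; move: (tw i); rewrite DE mul_diag_mx !mxE.
  set k := (X in (_ = _ * X)) => tk.
  exact: eq_of_absz_lt (ltn_ord _) (ltn_ord _) tk.
exists [seq e t | t : T]; split; last first.
  rewrite size_map -cardE detBE card_dep_ffun foldrE big_image /=.
  by apply: eq_bigr => i _; rewrite card_ord.
split.
- rewrite map_inj_uniq ?enum_uniq // => t w tw.
  by apply: (e_inj t w 0); rewrite tw subrr mulmx0.
- move=> v; have [w ->] : exists w, v = L *m w.
    by exists (invmx L *m v); rewrite mulKVmx.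
  exists (invmx R *m \col_i (- (w i ord0 %/ d`_i)%Z)); rewrite MB.
  apply/mapP; exists [ffun i => Ordinal (dlt (w i ord0) i)]; first by rewrite mem_enum.
  rewrite /e BE -!mulmxA (mulKVmx Ru) -mulmxDr.
  congr (_ *m _); apply/colP => i; rewrite DE mul_diag_mx !mxE ffunE /=.
  rewrite abszE ger0_norm ?modz_ge0 ?d0 //.
  by rewrite {1}(divz_eq (w i ord0) d`_i); ring.
- by move=> _ _ /mapP[t _ ->] /mapP[w _ ->] [m]; rewrite MB => /e_inj ->.
Qed.

End Cokernel.

(** * The group of quadratic polynomials and integer shifts *)

(** The element (n, (p, q, r)) stands for the shift t |-> t + n followed by
    the addition of the polynomial p + q t + r t^2. *)
Definition shift_group := (int * (int * int * int))%type.

HB.instance Definition _ := Choice.on shift_group.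

Section ShiftGroup.
Local Open Scope ring_scope.

Definition shift_mul (f g : shift_group) : shift_group :=
  let: (n, (p, q, r)) := f in let: (m, (p', q', r')) := g in
  (n + m, (p + m * q + m ^+ 2 * r + p', q + 2 * m * r + q', r + r')).

Definition shift_one : shift_group := (0, (0, 0, 0)).

Definition shift_inv (f : shift_group) : shift_group :=
  let: (n, (p, q, r)) := f in
  (- n, (- (p - n * q + n ^+ 2 * r), - (q - 2 * n * r), - r)).

Lemma shift_mulA : associative shift_mul.
Proof.
move=> [n1 [[p1 q1] r1]] [n2 [[p2 q2] r2]] [n3 [[p3 q3] r3]] /=.
by congr (_, (_, _, _)); ring.
Qed.

Lemma shift_mul1 : left_id shift_one shift_mul.
Proof. by move=> [n [[p q] r]] /=; congr (_, (_, _, _)); ring. Qed.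

Lemma shift_mulr1 : right_id shift_one shift_mul.
Proof. by move=> [n [[p q] r]] /=; congr (_, (_, _, _)); ring. Qed.

Lemma shift_mulV : left_inverse shift_one shift_inv shift_mul.
Proof. by move=> [n [[p q] r]] /=; congr (_, (_, _, _)); ring. Qed.

Lemma shift_mulrV : right_inverse shift_one shift_inv shift_mul.
Proof. by move=> [n [[p q] r]] /=; congr (_, (_, _, _)); ring. Qed.

End ShiftGroup.

HB.instance Definition _ := isGroup.Build shift_group
  shift_mulA shift_mul1 shift_mulr1 shift_mulV shift_mulrV.

Lemma shift_groupM n p q r m p' q' r' :
  ((n, (p, q, r)) : shift_group) * ((m, (p', q', r')) : shift_group) =
  ((n + m, (p + m * q + m ^+ 2 * r + p', q + 2 * m * r + q', r + r'))%R).
Proof. by []. Qed.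

Lemma shift_groupV n p q r :
  ((n, (p, q, r)) : shift_group)^-1 =
  ((- n, (- (p - n * q + n ^+ 2 * r), - (q - 2 * n * r), - r))%R).
Proof. by []. Qed.

Definition shiftE := (shift_groupM, shift_groupV).

(** Each commutator lowers the degree of the polynomial part, which makes the
    group nilpotent of class 3. *)
Lemma lower_central2_shift g : @lower_central shift_group 2 g ->
  exists p q, g = (0, (p, q, 0))%R.
Proof.
apply: (@lower_central_sub _ _
  [set g : shift_group | exists p q, g = (0, (p, q, 0))%R]).
  apply: group_closedP => [|_ _ [p [q ->]] [p' [q' ->]]|_ [p [q ->]]] /=.
  - by exists 0%R, 0%R.
  - by rewrite shiftE; do 2!eexists; congr (_, (_, _, _)); ring.
  - by rewrite shiftE; do 2!eexists; congr (_, (_, _, _)); ring.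
move=> [n [[p q] r]] [m [[p' q'] r']] _ /=; rewrite /commg /conjg !shiftE.
by do 2!eexists; congr (_, (_, _, _)); ring.
Qed.

Lemma lower_central3_shift g : @lower_central shift_group 3 g ->
  exists p, g = (0, (p, 0, 0))%R.
Proof.
apply: (@lower_central_sub _ _
  [set g : shift_group | exists p, g = (0, (p, 0, 0))%R]).
  apply: group_closedP => [|_ _ [p ->] [p' ->]|_ [p ->]] /=.
  - by exists 0%R.
  - by rewrite shiftE; eexists; congr (_, (_, _, _)); ring.
  - by rewrite shiftE; eexists; congr (_, (_, _, _)); ring.
move=> _ [m [[p' q'] r']] /lower_central2_shift[p [q ->]] /=.
rewrite /commg /conjg !shiftE.
by eexists; congr (_, (_, _, _)); ring.
Qed.

Lemma lower_central4_shift g : @lower_central shift_group 4 g -> g = 1.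
Proof.
apply: (@lower_central_sub _ _ [set g : shift_group | g = 1]).
  by apply: group_closedP => [|_ _ -> ->|_ ->] //=; rewrite ?mulg1 ?invg1.
move=> _ [m [[p' q'] r']] /lower_central3_shift[p ->] /=.
by rewrite /commg /conjg !shiftE; congr (_, (_, _, _)); ring.
Qed.

Lemma expgz_poly p q r n :
  expgz ((0, (p, q, r))%R : shift_group) n = (0, (n * p, n * q, n * r))%R.
Proof.
have := @expgz_unique _ (fun n => (0, (n * p, n * q, n * r))%R : shift_group).
rewrite !mul1r => <- // k m.
by rewrite shiftE; congr (_, (_, _, _)); ring.
Qed.

Lemma expgz_shift n :
  expgz ((1, (0, 0, 0))%R : shift_group) n = (n, (0, 0, 0))%R.
Proof.
rewrite -(@expgz_unique _ (fun n => (n, (0, 0, 0))%R : shift_group)) // => k m.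
by rewrite shiftE; congr (_, (_, _, _)); ring.
Qed.

(** * Normal forms in nilpotent groups *)

Definition normal_subset (G : groupType) (K : set G) :=
  [/\ K 1, forall g h, K g -> K h -> K (g * h), forall g, K g -> K g^-1
    & forall g h, K g -> K (g ^ h)].

Definition cyclic_extension (G : groupType) (g : G) (K : set G) :=
  [set h | exists n k, K k /\ h = expgz g n * k].

(** If g is central modulo K then so are its powers, hence the set of the
    products of a power of g and an element of K is a normal subgroup. *)
Lemma cyclic_extension_normal (G : groupType) (K : set G) g :
  normal_subset K -> (forall h, K [~ g, h]) ->
  normal_subset (cyclic_extension g K).
Proof.
move=> Kn gK; have [K1 KM KV KJ] := Kn.
have conj_pow n h : exists2 k, K k & expgz g n ^ h = expgz g n * k.
  elim: n => [|n [k Kk IH]|n [k Kk IH]].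
  - by exists 1 => //; rewrite conj1g mulg1.
  - exists ([~ g, h] ^ expgz g n * k); first by apply: KM => //; apply: KJ.
    rewrite -addn1 PoszD expgzS conjMg IH.
    by rewrite /commg /conjg !mulgA mulgK mulgV mul1g.
  - exists ([~ g, h]^-1 ^ (g^-1 * expgz g (- n%:Z)%R) * k).
      by apply: KM => //; apply: KJ; apply: KV.
    rewrite -addn1 PoszD opprD expgzB1 conjMg IH.
    by rewrite /commg /conjg !invgM !invgK !mulgA !mulgK mulVg mul1g.
split.
- by exists 0%R, 1; rewrite mulg1.
- move=> _ _ [n [k [Kk ->]]] [m [l [Kl ->]]].
  exists (n + m)%R, (k ^ expgz g m * l); split; first by apply: KM => //; apply: KJ.
  by rewrite expgzD /conjg !mulgA mulgK.
- move=> _ [n [k [Kk ->]]]; exists (- n)%R, (k^-1 ^ expgz g (- n)%R); split.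
    by apply: KJ; apply: KV.
  by rewrite /conjg invgM mulVKg expgzN.
- move=> _ h [n [k [Kk ->]]]; have [l Kl nl] := conj_pow n h.
  by exists n, (l * k ^ h); split; [by apply: KM => //; apply: KJ | rewrite conjMg nl -mulgA].
Qed.

Lemma normal_subset_commg r c (K : set (free_nilpotent r c)) g :
  normal_subset K -> (forall i, K [~ g, gen c i]) -> forall h, K [~ g, h].
Proof.
move=> [K1 KM KV KJ] Kg.
apply: (@free_nilpotent_ind _ _ [set h | K [~ g, h]]) => //.
apply: group_closedP => /= [|x y Kx Ky|x Kx].
- by rewrite commg1.
- have -> : [~ g, x * y] = [~ g, y] * [~ g, x] ^ y.
    by rewrite /commg /conjg !invgM !mulgA !mulgK.
  by apply: KM => //; apply: KJ.
- have -> : [~ g, x^-1] = ([~ g, x]^-1) ^ x^-1.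
    by rewrite /commg /conjg !invgM !invgK !mulgA mulgV mul1g.
  by apply: KJ; apply: KV.
Qed.

(** * Coordinates on the free nilpotent group of rank 2 and class 3 *)

Lemma ord2_ind (P : 'I_2 -> Prop) : P ord0 -> P ord_max -> forall i, P i.
Proof.
by move=> P0 P1 [[|[|//]] lti]; [move: P0|move: P1]; congr P; apply: val_inj.
Qed.

Notation N23 := (free_nilpotent 2 3).

Definition x_gen : N23 := gen 3 ord0.
Definition y_gen : N23 := gen 3 ord_max.
Definition z_gen := [~ y_gen, x_gen].
Definition u_gen := [~ z_gen, x_gen].
Definition v_gen := [~ z_gen, y_gen].

Definition normal_form (a b c d e : int) : N23 :=
  expgz x_gen a * (expgz y_gen b * (expgz z_gen c *
    (expgz u_gen d * expgz v_gen e))).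

(** The generator of each factor is central modulo the product of the factors
    to its right, so that these products are normal subgroups one after the
    other; the last one contains both generators x and y. *)
Lemma normal_form_exists g : exists a b c d e, g = normal_form a b c d e.
Proof.
have triv : normal_subset [set 1 : N23].
  by split=> //= [? ? -> ->|? ->|? ? ->]; rewrite ?mulg1 ?invg1 ?conj1g.
have central w h : lower_central 3 w -> [~ w, h] = 1 :> N23.
  by move=> w3; apply: lower_central_free_nilpotent; apply: lower_centralS.
have z2 : lower_central 2 z_gen by apply: lower_centralS.
pose K2 := cyclic_extension v_gen [set 1].
have Kv : normal_subset K2.
  by apply: cyclic_extension_normal => // h; apply: central; apply: lower_centralS.
pose K3 := cyclic_extension u_gen K2.
have Ku : normal_subset K3.
  apply: cyclic_extension_normal => // h.
  by rewrite central; [case: Kv | apply: lower_centralS].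
have sub (K : set N23) w : K 1 -> cyclic_extension w K w.
  by move=> K1; exists 1%R, 1; rewrite mulg1.
have sub' (K : set N23) w h : K h -> cyclic_extension w K h.
  by move=> Kh; exists 0%R, h; rewrite mul1g.
pose K4 := cyclic_extension z_gen K3.
have Kz : normal_subset K4.
  apply: cyclic_extension_normal => //; apply: normal_subset_commg => //.
  apply: ord2_ind; first by apply: sub; case: Kv.
  by apply/sub'/sub.
pose K5 := cyclic_extension y_gen K4.
have Ky : normal_subset K5.
  apply: cyclic_extension_normal => //; apply: normal_subset_commg => //.
  apply: ord2_ind; first by apply: sub; case: Ku.
  by rewrite commgg; case: Kz.
have Kx : normal_subset (cyclic_extension x_gen K5).
  apply: cyclic_extension_normal => //; apply: normal_subset_commg => //.
  apply: ord2_ind; first by rewrite commgg; case: Ky.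
  (* Here the commutator is the inverse of z. *)
  rewrite -invgR -/y_gen -/x_gen; case: Ky => _ _ KV _; apply: KV.
  by apply/sub'/sub; case: Ku.
have [K1 KM KV _] := Kx.
have : cyclic_extension x_gen K5 g.
  apply: free_nilpotent_ind; first exact: group_closedP.
  apply: ord2_ind; first by apply: sub; case: Ky.
  by apply/sub'/sub; case: Kz.
move=> [a [_ [[b [_ [[c [_ [[d [_ [[e [_ [-> ->]]] ->]]] ->]]] ->]]] ->]]].
by exists a, b, c, d, e; rewrite mulg1.
Qed.

(** The generator i acts as the shift by 1 and the other one as the polynomial
    t^2. For the first of the two representations z is 2t + 1, u is the
    constant 2 and v is trivial; for the second one the roles of u and v are
    exchanged, up to signs. Together they separate the exponents of a normal
    form. *)
Lemma shift_rep_exists (i : 'I_2) :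
  exists h : {multiplicative N23 -> shift_group},
    forall j, h (gen 3 j) = if j == i then (1, (0, 0, 0))%R else (0, (0, 0, 1))%R.
Proof. exact: free_nilpotent_lift lower_central4_shift. Qed.

Definition shift_rep i := sval (cid (shift_rep_exists i)).

Lemma shift_rep_gen i j :
  shift_rep i (gen 3 j) = if j == i then (1, (0, 0, 0))%R else (0, (0, 0, 1))%R.
Proof. exact: (svalP (cid (shift_rep_exists i))). Qed.

Lemma shift_rep0_normal_form a b c d e :
  shift_rep ord0 (normal_form a b c d e) = (a, (c + 2 * d, 2 * c, b))%R.
Proof.
rewrite /normal_form !gmulfM !gmorph_expgz !gmorphR !shift_rep_gen /=.
rewrite /commg /conjg !shiftE !expgz_shift !expgz_poly.
rewrite !shiftE.
by congr (_, (_, _, _)); ring.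
Qed.

Lemma shift_rep1_normal_form a b c d e :
  shift_rep ord_max (normal_form a b c d e) =
  (b, (a * b ^+ 2 - c - 2 * e, 2 * a * b - 2 * c, a))%R.
Proof.
rewrite /normal_form !gmulfM !gmorph_expgz !gmorphR !shift_rep_gen /=.
rewrite /commg /conjg !shiftE !expgz_shift !expgz_poly.
rewrite !shiftE.
by congr (_, (_, _, _)); ring.
Qed.

Lemma coordinates_exist : exists t : N23 -> int * int * int * int * int,
  forall g, normal_form (t g).1.1.1.1 (t g).1.1.1.2 (t g).1.1.2 (t g).1.2 (t g).2 = g.
Proof.
have ex g : exists t : int * int * int * int * int,
    normal_form t.1.1.1.1 t.1.1.1.2 t.1.1.2 t.1.2 t.2 = g.
  by have [a [b [c [d [e ->]]]]] := normal_form_exists g; exists (a, b, c, d, e).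
by have [t tP] := choice ex; exists t.
Qed.

Definition coordinates := sval (cid coordinates_exist).

Definition coord_a g := (coordinates g).1.1.1.1.
Definition coord_b g := (coordinates g).1.1.1.2.
Definition coord_c g := (coordinates g).1.1.2.
Definition coord_d g := (coordinates g).1.2.
Definition coord_e g := (coordinates g).2.

Lemma coordK g :
  normal_form (coord_a g) (coord_b g) (coord_c g) (coord_d g) (coord_e g) = g.
Proof. exact: (svalP (cid coordinates_exist)). Qed.

Lemma shift_rep0E g : shift_rep ord0 g =
  (coord_a g, (coord_c g + 2 * coord_d g, 2 * coord_c g, coord_b g))%R.
Proof. by rewrite -{1}[g]coordK shift_rep0_normal_form. Qed.

Lemma shift_rep1E g : shift_rep ord_max g =
  (coord_b g, (coord_a g * coord_b g ^+ 2 - coord_c g - 2 * coord_e g,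
               2 * coord_a g * coord_b g - 2 * coord_c g, coord_a g))%R.
Proof. by rewrite -{1}[g]coordK shift_rep1_normal_form. Qed.

(** The exponents a, b, c, d are read off the first representation, and then e
    off the second one. *)
Lemma normal_formK a b c d e (g := normal_form a b c d e) :
  [/\ coord_a g = a, coord_b g = b, coord_c g = c, coord_d g = d & coord_e g = e].
Proof.
have := shift_rep0_normal_form a b c d e; rewrite -/g shift_rep0E.
move=> [ga gcd gc gb].
have := shift_rep1_normal_form a b c d e; rewrite -/g shift_rep1E ga gb.
move=> [gce _].
have cE : coord_c g = c by lia.
by split => //; lia.
Qed.

Section Coordinates.
Local Open Scope ring_scope.

Lemma coord_aM g h : coord_a (g * h)%g = coord_a g + coord_a h.
Proof.
by have := @gmulfM _ _ (shift_rep ord0) g h; rewrite !shift_rep0E shiftE => -[].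
Qed.

Lemma coord_bM g h : coord_b (g * h)%g = coord_b g + coord_b h.
Proof.
by have := @gmulfM _ _ (shift_rep ord_max) g h; rewrite !shift_rep1E shiftE => -[].
Qed.

Lemma coord_cM g h : coord_c (g * h)%g = coord_c g + coord_c h + coord_b g * coord_a h.
Proof.
have := @gmulfM _ _ (shift_rep ord0) g h; rewrite !shift_rep0E shiftE => -[_ _ + _].
move=> e; apply: (@mulfI _ 2) => //; rewrite e; ring.
Qed.

Lemma coord_dM g h : coord_b g = 0 ->
  coord_d (g * h)%g = coord_d g + coord_d h + coord_c g * coord_a h.
Proof.
move=> gb; have := @gmulfM _ _ (shift_rep ord0) g h.
rewrite !shift_rep0E shiftE coord_cM gb => -[_ + _ _].
move=> e; apply: (@mulfI _ 2) => //; apply: (addrI (coord_c g + coord_c h)).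
by move: e; rewrite mul0r addr0 => ->; ring.
Qed.

Lemma coord_dMr g h : coord_a h = 0 -> coord_d (g * h)%g = coord_d g + coord_d h.
Proof.
move=> ha; have := @gmulfM _ _ (shift_rep ord0) g h.
rewrite !shift_rep0E shiftE coord_cM ha => -[_ + _ _].
move=> e; apply: (@mulfI _ 2) => //; apply: (addrI (coord_c g + coord_c h)).
by move: e; rewrite mulr0 addr0 => ->; ring.
Qed.

Lemma coord_eM g h : coord_a g = 0 -> coord_b g = 0 ->
  coord_e (g * h)%g = coord_e g + coord_e h + coord_c g * coord_b h.
Proof.
move=> ga gb; have := @gmulfM _ _ (shift_rep ord_max) g h.
rewrite !shift_rep1E shiftE coord_cM coord_aM coord_bM ga gb => -[+ _].
by rewrite !mul0r !add0r !mulr0; lia.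
Qed.

Lemma coord_eMr g h : coord_a h = 0 -> coord_b h = 0 ->
  coord_e (g * h)%g = coord_e g + coord_e h.
Proof.
move=> ha hb; have := @gmulfM _ _ (shift_rep ord_max) g h.
rewrite !shift_rep1E shiftE coord_cM coord_aM coord_bM ha hb => -[+ _].
by rewrite !mul0r !addr0 !mulr0; lia.
Qed.

Definition col2 (a b : int) : 'cV[int]_2 := \col_i (if i == ord0 then a else b).

Lemma col2P (v : 'cV[int]_2) : v = col2 (v ord0 ord0) (v ord_max ord0).
Proof. by apply/colP; apply: ord2_ind; rewrite !mxE. Qed.

Lemma col2_eq a b a' b' : col2 a b = col2 a' b' <-> a = a' /\ b = b'.
Proof.
split=> [/colP e|[-> ->] //].
by have := e ord0; have := e ord_max; rewrite !mxE.
Qed.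

Lemma col2_eq0 a b : col2 a b = 0 <-> a = 0 /\ b = 0.
Proof. by rewrite -col2_eq (_ : col2 0 0 = 0) //; apply/colP=> i; rewrite !mxE if_same. Qed.

Lemma col2D a b a' b' : col2 a b + col2 a' b' = col2 (a + a') (b + b').
Proof. by apply/colP; apply: ord2_ind; rewrite !mxE. Qed.

Lemma col2Z k a b : k *: col2 a b = col2 (k * a) (k * b).
Proof. by apply/colP; apply: ord2_ind; rewrite !mxE. Qed.

(** The layers are the factors of the lower central series: the exponents of
    x and y, then of z, then of u and v. *)
Definition layer1 g := col2 (coord_a g) (coord_b g).
Definition layer2 g := coord_c g.
Definition layer3 g := col2 (coord_d g) (coord_e g).

Lemma layer_inj g h :
  layer1 g = layer1 h -> layer2 g = layer2 h -> layer3 g = layer3 h -> g = h.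
Proof.
move=> /col2_eq[ga gb] gc /col2_eq[gd ge]; rewrite -[g]coordK -[h]coordK.
by rewrite ga gb gd ge -/(layer2 g) gc.
Qed.

Lemma layer_surj (v1 : 'cV[int]_2) v2 (v3 : 'cV[int]_2) :
  exists g, [/\ layer1 g = v1, layer2 g = v2 & layer3 g = v3].
Proof.
exists (normal_form (v1 ord0 ord0) (v1 ord_max ord0) v2
                    (v3 ord0 ord0) (v3 ord_max ord0)).
rewrite /layer1 /layer2 /layer3.
by have [-> -> -> -> ->] := normal_formK (v1 ord0 ord0) (v1 ord_max ord0) v2
  (v3 ord0 ord0) (v3 ord_max ord0); rewrite -!col2P.
Qed.

Lemma layer1M g h : layer1 (g * h)%g = layer1 g + layer1 h.
Proof. by rewrite /layer1 coord_aM coord_bM col2D. Qed.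

Lemma layer2M g h : layer1 g = 0 ->
  layer2 (g * h)%g = layer2 g + layer2 h /\ layer2 (h * g)%g = layer2 h + layer2 g.
Proof.
by move=> /col2_eq0[ga gb]; rewrite /layer2 !coord_cM ga gb mul0r mulr0 !addr0.
Qed.

(** The last term is the contribution of the commutators that appear when the
    z-part of g is moved across the x- and y-parts of h. *)
Lemma layer3Ml g h : layer1 g = 0 ->
  layer3 (g * h)%g = layer3 g + layer3 h + layer2 g *: layer1 h.
Proof.
move=> /col2_eq0[ga gb]; rewrite /layer3 coord_dM // coord_eM //.
by rewrite col2Z !col2D.
Qed.

Lemma layer3Mr g h : layer1 h = 0 -> layer3 (g * h)%g = layer3 g + layer3 h.
Proof.
by move=> /col2_eq0[ha hb]; rewrite /layer3 coord_dMr // coord_eMr // col2D.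
Qed.

Lemma layer3M g h : layer1 g = 0 -> layer2 g = 0 ->
  layer3 (g * h)%g = layer3 g + layer3 h /\ layer3 (h * g)%g = layer3 h + layer3 g.
Proof. by move=> g1 g2; rewrite layer3Ml // g2 scale0r addr0 layer3Mr. Qed.

Lemma layer1_commg g h : layer1 [~ g, h]%g = 0.
Proof.
have := congr1 layer1 (commgC g h); rewrite !layer1M => e.
by apply: (addrI (layer1 h + layer1 g)); rewrite -e addr0 addrC.
Qed.

(** On the second layer the commutator is the determinant form on the
    abelianization. *)
Lemma layer2_commg g h :
  layer2 [~ g, h]%g = coord_b g * coord_a h - coord_b h * coord_a g.
Proof.
have := congr1 layer2 (commgC g h).
rewrite (layer2M _ (layer1_commg g h)).2 /layer2 !coord_cM; lia.
Qed.

Lemma layer2_commg0 g h : layer1 g = 0 -> layer2 [~ g, h]%g = 0.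
Proof. by move=> /col2_eq0[ga gb]; rewrite layer2_commg ga gb mul0r mulr0. Qed.

Lemma layer3_commg g h : layer1 g = 0 -> layer3 [~ g, h]%g = layer2 g *: layer1 h.
Proof.
move=> g1; have := congr1 layer3 (commgC g h).
rewrite (layer3M _ (layer1_commg g h) (layer2_commg0 h g1)).2.
rewrite layer3Ml // layer3Mr // => e.
by apply: (addrI (layer3 h + layer3 g)); rewrite -e [layer3 h + _]addrC.
Qed.

End Coordinates.

(** * Endomorphisms in coordinates *)

Lemma subgroup_expgz (G : groupType) (K : set G) g n :
  K 1 -> (forall x y, K x -> K y -> K (x * y)) -> (forall x, K x -> K x^-1) ->
  K g -> K (expgz g n).
Proof.
move=> K1 KM KV Kg; elim: n => [//|n IH|n IH].
  by rewrite -addn1 PoszD expgzS; apply: KM.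
by rewrite -addn1 PoszD opprD expgzB1; apply: KM => //; apply: KV.
Qed.

Section Matrix2.
Local Open Scope ring_scope.

Lemma big_ord2 (R : zmodType) (F : 'I_2 -> R) : \sum_i F i = F ord0 + F ord_max.
Proof. by rewrite big_ord_recr big_ord1; congr (F _ + F _); apply: val_inj. Qed.

Lemma det_mx2 (M : 'M[int]_2) :
  \det M = M ord0 ord0 * M ord_max ord_max - M ord0 ord_max * M ord_max ord0.
Proof.
rewrite (expand_det_row _ ord0) big_ord2 /cofactor !det_mx11 !mxE.
have -> : lift ord0 ord0 = ord_max :> 'I_2 by apply: val_inj.
have -> : lift ord_max ord0 = ord0 :> 'I_2 by apply: val_inj.
by rewrite /= expr0 expr1; ring.
Qed.

Lemma mxtrace2 (M : 'M[int]_2) : \tr M = M ord0 ord0 + M ord_max ord_max.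
Proof. exact: big_ord2. Qed.

Lemma det_sub1 (M : 'M[int]_2) : \det (M - 1%:M) = 1 - \tr M + \det M.
Proof. by rewrite !det_mx2 mxtrace2 !mxE /=; ring. Qed.

Lemma mulmx_fix n (M : 'M[int]_n) (v : 'cV_n) :
  \det (M - 1%:M) != 0 -> M *m v = v -> v = 0.
Proof.
move=> d0 Mv; have : \adj (M - 1%:M) *m ((M - 1%:M) *m v) = 0.
  by rewrite mulmxBl mul1mx Mv subrr mulmx0.
rewrite mulmxA mul_adj_mx mul_scalar_mx => /colP dv.
apply/colP => i; apply: (mulfI d0).
by have := dv i; rewrite !mxE mulr0.
Qed.

End Matrix2.

Lemma layer1E g i : layer1 g i ord0 = (shift_rep i g).1.
Proof.
by elim/ord2_ind: i; rewrite !mxE /= ?shift_rep0E ?shift_rep1E.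
Qed.

Lemma layer1_gen j : layer1 (gen 3 j) = delta_mx j ord0.
Proof.
apply/colP => i; rewrite layer1E !mxE shift_rep_gen eqxx andbT [j == i]eq_sym.
by case: eqP.
Qed.

Section Endomorphism.
Variable phi : {multiplicative N23 -> N23}.
Local Open Scope ring_scope.

(** The matrix of the action on the abelianization, in the basis x, y. *)
Definition ab_matrix : 'M[int]_2 :=
  \matrix_(i, j) layer1 (phi (gen 3 j)) i ord0.
Local Notation A := ab_matrix.

Lemma ab_matrixE i j : A i j = (shift_rep i (phi (gen 3 j))).1.
Proof. by rewrite mxE layer1E. Qed.

Lemma layer1_endo g : layer1 (phi g) = A *m layer1 g.
Proof.
apply: (@free_nilpotent_ind _ _ [set g | layer1 (phi g) = A *m layer1 g]).
  apply: group_closedP => /= [|x y xA yA|x xA].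
  - by rewrite gmorph1 (layer1_1 layer1M) mulmx0.
  - by rewrite gmulfM !layer1M xA yA mulmxDr.
  - by rewrite gmorphV !(layer1V layer1M) xA mulmxN.
by move=> i /=; rewrite layer1_gen -colE; apply/colP => j; rewrite !mxE.
Qed.

Lemma layer1_endo0 g : layer1 g = 0 -> layer1 (phi g) = 0.
Proof. by rewrite layer1_endo => ->; rewrite mulmx0. Qed.

(** The second factor is generated by z = [y, x], whose image is the commutator
    of the images of y and x: its coordinate is the determinant of A. *)
Lemma layer2_endo g : layer1 g = 0 -> layer2 (phi g) = \det A * layer2 g.
Proof.
pose K := [set g | layer1 g = 0 /\ layer2 (phi g) = \det A * layer2 g].
have K1 : K 1%g.
  by rewrite /K /= gmorph1 (layer1_1 layer1M) (layer2_1 layer1M layer2M) mulr0.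
have KM x y : K x -> K y -> K (x * y)%g.
  move=> [x1 xA] [y1 yA]; rewrite /K /= layer1M x1 y1 addr0; split=> //.
  by rewrite gmulfM !(layer2M _ _).1 ?layer1_endo0 // xA yA mulrDr.
have KV x : K x -> K x^-1%g.
  move=> [x1 xA]; rewrite /K /= (layer1V layer1M) x1 oppr0; split=> //.
  by rewrite gmorphV !(layer2V layer1M layer2M) ?layer1_endo0 // xA mulrN.
have Kz : K z_gen.
  split; first exact: layer1_commg.
  have -> : layer2 z_gen = 1.
    have /colP x1 := layer1_gen ord0; have /colP y1 := layer1_gen ord_max.
    move: (x1 ord0) (x1 ord_max) (y1 ord0) (y1 ord_max).
    by rewrite layer2_commg !mxE /= => -> -> -> ->.
  by rewrite gmorphR layer2_commg det_mx2 !mxE /= /x_gen /y_gen; ring.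
have KR g' h : layer1 g' = 0 -> K [~ g', h]%g.
  move=> g1; split; first exact: layer1_commg.
  by rewrite gmorphR !layer2_commg0 ?mulr0 // layer1_endo0.
move=> g1; suff [] : K g by [].
move: (g1) => /col2_eq0[ga gb].
rewrite -[g]coordK ga gb /normal_form /= !mul1g.
have z1 : layer1 z_gen = 0 by apply: layer1_commg.
by apply: (KM); last apply: (KM); apply: subgroup_expgz => //; apply: KR.
Qed.

(** The third factor is generated by the commutators of z with x and y, hence it
    is the tensor product of the first two. *)
Lemma layer3_endo g : layer1 g = 0 -> layer2 g = 0 ->
  layer3 (phi g) = (\det A *: A) *m layer3 g.
Proof.
pose K := [set g | [/\ layer1 g = 0, layer2 g = 0
                     & layer3 (phi g) = (\det A *: A) *m layer3 g]].
have phi0 x : layer1 x = 0 -> layer2 x = 0 -> layer2 (phi x) = 0.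
  by move=> x1; rewrite layer2_endo // => ->; rewrite mulr0.
have K1 : K 1%g.
  rewrite /K /= gmorph1 (layer1_1 layer1M) (layer2_1 layer1M layer2M).
  by rewrite (layer3_1 layer1M layer2M layer3M) mulmx0.
have KM x y : K x -> K y -> K (x * y)%g.
  move=> [x1 x2 xA] [y1 y2 yA].
  rewrite /K /= layer1M (layer2M _ x1).1 x1 y1 x2 y2 !addr0; split=> //.
  rewrite gmulfM (layer3M _ x1 x2).1 (layer3M _ (layer1_endo0 x1) (phi0 x x1 x2)).1.
  by rewrite xA yA mulmxDr.
have KV x : K x -> K x^-1%g.
  move=> [x1 x2 xA].
  rewrite /K /= (layer1V layer1M) (layer2V layer1M layer2M) // x1 x2 !oppr0.
  split=> //; rewrite gmorphV !(layer3V layer1M layer2M layer3M) ?layer1_endo0 ?phi0 //.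
  by rewrite xA mulmxN.
have KR g' h : layer1 g' = 0 -> K [~ g', h]%g.
  move=> g1; split; [exact: layer1_commg | exact: layer2_commg0 |].
  rewrite gmorphR (layer3_commg _ (layer1_endo0 g1)) (layer3_commg _ g1).
  rewrite layer2_endo // layer1_endo.
  by rewrite -scalemxAl -scalemxAr scalerA.
move=> g1 g2; suff [] : K g by [].
move: (g1) => /col2_eq0[ga gb].
rewrite -[g]coordK ga gb -/(layer2 g) g2 /normal_form /= !mul1g.
have z1 : layer1 z_gen = 0 by apply: layer1_commg.
by apply: (KM); apply: subgroup_expgz => //; apply: KR.
Qed.

(** * Reidemeister numbers of endomorphisms *)

(** A vector v with v (A - 1) = 0 gives an invariant of the twisted classes, the
    product of v with the first layer, that takes infinitely many values. *)
Lemma reidemeister_det_sub1 : \det (A - 1%:M) = 0 -> reidemeister_number phi = None.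
Proof.
move=> /eqP/det0P[v v0 vA].
have /existsP[i vi] : [exists i, v ord0 i != 0].
  rewrite -negb_forall; apply: contraNN v0 => /forallP v0.
  by apply/eqP/rowP => i; rewrite mxE; apply/eqP.
have [e eP] : exists e : nat -> N23, forall n, layer1 (e n) = n%:R *: delta_mx i ord0.
  have ex (n : nat) : exists g, layer1 g = n%:R *: delta_mx i ord0.
    by have [g [g1 _ _]] := layer_surj (n%:R *: delta_mx i ord0) 0 0; exists g.
  by have [e eP] := choice ex; exists e.
apply: (reidemeister_infinite (e := e)) => n m /twisted_conjE[x emE].
have := layer1_shift layer1M layer1_endo x (e n).
rewrite -emE !eP -[X in _ - X]mul1mx -mulmxBl => /(congr1 (mulmx v)).
rewrite mulmxDr mulmxA vA mul0mx addr0 -!scalemxAr -colE => /rowP/(_ ord0).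
by rewrite !mxE => /(mulIf vi)/eqP; rewrite eqr_nat => /eqP.
Qed.

(** When A - 1 is injective, an element that conjugates two powers of z lies in
    the second step of the series; since phi acts trivially on the second factor, the
    powers of z are pairwise not twisted conjugate. *)
Lemma reidemeister_det1 : \det A = 1 -> reidemeister_number phi = None.
Proof.
move=> dA; have [/reidemeister_det_sub1 //|d0] := eqVneq (\det (A - 1%:M)) 0.
have [e eP] : exists e : nat -> N23, forall n, layer1 (e n) = 0 /\ layer2 (e n) = n%:R.
  have ex (n : nat) : exists g, layer1 g = 0 /\ layer2 g = n%:R.
    by have [g [g1 g2 _]] := layer_surj 0 n%:R 0; exists g.
  by have [e eP] := choice ex; exists e.
apply: (reidemeister_infinite (e := e)) => n m /twisted_conjE[x emE].
have [[n1 n2] [m1 m2]] := (eP n, eP m).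
have := layer1_shift layer1M layer1_endo x (e n).
rewrite -emE n1 m1 add0r => /esym/subr0_eq/(mulmx_fix d0) x1.
have := layer2_shift layer1M layer2M layer1_endo layer2_endo (mulmx0 _ _) (e n) x1.
by rewrite -emE n2 m2 dA mul1r subrr addr0 => /eqP; rewrite eqr_nat => /eqP.
Qed.

Lemma transversal_opp : coset_transversal (fun c : int => -1 * c) [:: 0; 1].
Proof.
split=> // [v|v w].
- exists (v %/ 2)%Z; rewrite !inE; apply/orP.
  have := divz_eq v 2; have := modz_ge0 v (d := 2) isT.
  have := ltz_pmod v (d := 2) isT; lia.
- by rewrite !inE => /orP[]/eqP-> /orP[]/eqP-> [m]; lia.
Qed.

(** The three factors contribute |det (A - 1)| = |tr A|, the index 2 of the image
    of -2 and |det (- A - 1)| = |tr A|. *)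
Lemma reidemeister_detN1 : \det A = -1 -> \tr A != 0 ->
  reidemeister_number phi = Some (2 * `|\tr A| ^ 2)%N.
Proof.
move=> dA tA.
have d1 : \det (A - 1%:M) = - \tr A by rewrite det_sub1 dA; ring.
have d3 : \det (\det A *: A - 1%:M) = \tr A.
  by rewrite det_sub1 mxtraceZ detZ dA; ring.
have [s1 [t1 z1]] : exists s, coset_transversal (fun v : 'cV_2 => A *m v) s /\ size s = `|\tr A|%N.
  by have := transversal_mulmx (M := A); rewrite d1 abszN oppr_eq0 => /(_ tA).
have [s3 [t3 z3]] :
    exists s,
      coset_transversal (fun v : 'cV_2 => (\det A *: A) *m v) s /\ size s = `|\tr A|%N.
  by have := transversal_mulmx (M := \det A *: A); rewrite d3 => /(_ tA).
have f1_fix (v : 'cV_2) : A *m v = v -> v = 0.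
  by apply: mulmx_fix; rewrite d1 oppr_eq0.
have f2_fix (c : int) : \det A * c = c -> c = 0 by rewrite dA; lia.
have t2 : coset_transversal (fun c => \det A * c) [:: 0; 1].
  by rewrite dA; apply: transversal_opp.
have -> : (2 * `|\tr A| ^ 2 = size s1 * 2 * size s3)%N.
  by rewrite z1 z3 /=; lia.
exact: (reidemeister_layers layer1M layer2M layer3M layer_inj layer_surj
  layer1_endo layer2_endo layer3_endo (mulmx0 _ _) (mulr0 _) f1_fix f2_fix t1 t2 t3).
Qed.

End Endomorphism.

(** * The spectrum *)

Section Automorphisms.
Local Open Scope ring_scope.

Lemma ab_matrix_bijective (phi : {multiplicative N23 -> N23}) :
  bijective phi -> \det (ab_matrix phi) = 1 \/ \det (ab_matrix phi) = -1.
Proof.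
move=> [psi _ psiK].
pose B := \matrix_(i, j) layer1 (psi (gen 3 j)) i ord0.
have AB : ab_matrix phi *m B = 1%:M.
  apply/matrixP => i j; have /matrixP/(_ i ord0) := layer1_endo phi (psi (gen 3 j)).
  rewrite psiK layer1_gen !mxE eqxx andbT => ->.
  by apply: eq_bigr => k _; rewrite !mxE.
by have [/absz_det_unitmx] := mulmx1_unit AB; lia.
Qed.

Lemma reidemeister_id : reidemeister_number (@idfun N23) = None.
Proof.
apply: (reidemeister_det_sub1 (phi := idfun)).
suff -> : ab_matrix idfun = 1%:M by rewrite subrr det0.
by apply/matrixP => i j; rewrite mxE layer1_gen !mxE eqxx andbT.
Qed.

(** x is sent to x^k y and y to x; the inverse sends x to y and y to y^-k x. *)
Lemma automorphism_exists (k : nat) : exists phi : {multiplicative N23 -> N23},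
  [/\ bijective phi, \det (ab_matrix phi) = -1 & \tr (ab_matrix phi) = k%:Z].
Proof.
have nil := @lower_central_free_nilpotent 2 3.
have [phi phiE] := free_nilpotent_lift (fun i : 'I_2 =>
  if i == ord0 then (expgz x_gen k%:Z * y_gen)%g else x_gen) nil.
have [psi psiE] := free_nilpotent_lift (fun i : 'I_2 =>
  if i == ord0 then y_gen else (expgz y_gen (- k%:Z) * x_gen)%g) nil.
have phix : phi x_gen = (expgz x_gen k%:Z * y_gen)%g by apply: phiE.
have phiy : phi y_gen = x_gen by apply: phiE.
have psix : psi x_gen = y_gen by apply: psiE.
have psiy : psi y_gen = (expgz y_gen (- k%:Z) * x_gen)%g by apply: psiE.
exists phi; split.
- exists psi.
    apply: (gmorph_eq_gen (f := psi \o phi) (g := idfun)); apply: ord2_ind => /=.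
      by rewrite -/x_gen phix gmulfM gmorph_expgz psix psiy expgzN mulVKg.
    by rewrite -/y_gen phiy psix.
  apply: (gmorph_eq_gen (f := phi \o psi) (g := idfun)); apply: ord2_ind => /=.
    by rewrite -/x_gen psix phiy.
  by rewrite -/y_gen psiy gmulfM gmorph_expgz phix phiy expgzN mulKg.
- rewrite det_mx2 !ab_matrixE -/x_gen -/y_gen phix phiy !gmulfM !gmorph_expgz.
  rewrite !shift_rep_gen /= expgz_shift expgz_poly !shiftE /=; ring.
- rewrite mxtrace2 !ab_matrixE -/x_gen -/y_gen phix phiy !gmulfM !gmorph_expgz.
  by rewrite !shift_rep_gen /= expgz_shift !shiftE /= !addr0.
Qed.

End Automorphisms.

Theorem mainTheorem2 :
  reidemeister_spectrum (free_nilpotent 2 3) =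
  [set Some (2 * k ^ 2)%N | k in [set k : nat | (0 < k)%N]] `|` [set None].
Proof.
apply/seteqP; split=> [_ [phi /ab_matrix_bijective[d|d] <-]|_ [[k k0 <-]|->]].
- by right; apply: reidemeister_det1.
- have [t0|t0] := eqVneq (\tr (ab_matrix phi))%R 0%R.
    by right; apply: reidemeister_det_sub1; rewrite det_sub1 d t0.
  left; exists (absz (\tr (ab_matrix phi))%R); first by rewrite /= absz_gt0.
  by rewrite reidemeister_detN1.
- have [phi [phi_bij d t]] := automorphism_exists k.
  by exists phi => //; rewrite reidemeister_detN1 // t // eqz_nat -lt0n.
- by exists idfun; [exists idfun | apply: reidemeister_id].
Qed.
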